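(* (a) Fix $\delta\in\{-1,1\}^p$ and an interval $I\subset(0,\infty)$, and consider the family of parallel hyperplanes $\{\beta:\langle\delta,\beta\rangle=t\}$, $t\in I$, which contain the corresponding faces of maximal dimension of $B(t)$. The locus of the points of tangency of the family of ellipsoids $E_\mu$ with this family of parallel hyperplanes is a segment belonging to a straight line that contains the center $\hat\beta$ of the ellipsoids. (b) Let $\pi$ be a hyperplane that contains the center $\hat\beta$ of the ellipsoids $E_\mu$. If two hyperplanes parallel to each other (and to $\pi$) both belong to the same one of the two open half-spaces defined by $\pi$, then their contact points with the ellipsoids of the family $E_\mu$ belong to the same ray, which has $\hat\beta$ as its initial point.
   Context: Let $p\ge2$, let $K_1$ be a symmetric positive definite real $p\times p$ matrix (the covariance matrix of the predictors of a full rank data set), $b\in\mathbb R^p$, $\hat\beta=K_1^{-1}b$. The ellipsoids $E_\mu$ form the homothetic family $\langle K_1(\beta-\hat\beta),\beta-\hat\beta\rangle=\mu+\langle K_1^{-1}b,b\rangle-J_{kk}$ in $\mathbb R^p$, where $J_{kk}$ is a constant and $\mu$ varies over all values for which the right-hand side is nonnegative; the degenerate ellipsoid $\{\hat\beta\}$ is regarded as tangent to every hyperplane through $\hat\beta$. $B(t)=\{\beta\in\mathbb R^p:\sum_j|\beta_j|=t\}$ for $t>0$. *)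

(* Defs.v *)
From mathcomp Require Import all_boot all_order all_algebra.
From mathcomp Require Import all_classical all_reals all_analysis.

Set Implicit Arguments.
Unset Strict Implicit.
Unset Printing Implicit Defensive.

Import Order.TTheory GRing.Theory Num.Theory.
Import numFieldNormedType.Exports.

Local Open Scope classical_set_scope.
Local Open Scope ring_scope.

Section Geometry.
Context {R : realType} {p : nat}.
Implicit Types (u v n d x y beta : 'cV[R]_p) (H : set 'cV[R]_p) (t c : R).

Definition dotv u v : R := \sum_(j < p) u j 0 * v j 0.

Definition posdef (K : 'M[R]_p) : Prop :=
  forall v, v != 0 -> 0 < dotv (K *m v) v.

Definition hyperplane n c : set 'cV[R]_p := [set beta | dotv n beta = c].

Definition upper_half_space n c : set 'cV[R]_p := [set beta | c < dotv n beta].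
Definition lower_half_space n c : set 'cV[R]_p := [set beta | dotv n beta < c].

(* Coincident hyperplanes count as parallel. *)
Definition parallel H1 H2 : Prop :=
  exists n c1 c2, [/\ n != 0, H1 = hyperplane n c1 & H2 = hyperplane n c2].

Definition line x d : set 'cV[R]_p := [set x + s *: d | s in [set: R]].

Definition ray x d : set 'cV[R]_p := [set x + s *: d | s in [set s | 0 <= s]].

(* B(t) is the l1-sphere.  Its face of maximal dimension attached to a sign
   vector delta is its part in the closed orthant of delta, i.e. the simplex
   with vertices t * delta_j * e_j. *)
Definition l1_sphere t : set 'cV[R]_p :=
  [set beta | \sum_(j < p) `|beta j 0| = t].

Definition l1_face (delta : 'cV[R]_p) t : set 'cV[R]_p :=
  [set beta | l1_sphere t beta /\ forall j, 0 <= delta j 0 * beta j 0].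

(* The affine tangent space at x of the level set of f through x: x plus the
   kernel of the differential of f at x. *)
Definition tangent_plane (f : 'cV[R]_p -> R) x : set 'cV[R]_p :=
  [set y | 'D_(y - x) f x = 0].

End Geometry.

Section Ellipsoids.
Context {R : realType} {p : nat}.
Variables (K : 'M[R]_p) (b : 'cV[R]_p) (J : R).

Definition beta_hat : 'cV[R]_p := invmx K *m b.

Definition centered_form (beta : 'cV[R]_p) : R :=
  dotv (K *m (beta - beta_hat)) (beta - beta_hat).

Definition level (mu : R) : R := mu + dotv (invmx K *m b) b - J.

Definition ellipsoid (mu : R) : set 'cV[R]_p :=
  [set beta | centered_form beta = level mu].

(* The case level mu = 0 is the convention that the degenerate ellipsoid
   {beta_hat} is tangent to every hyperplane through beta_hat. *)
Definition tangent_at (mu : R) (H : set 'cV[R]_p) (beta : 'cV[R]_p) : Prop :=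
  [/\ ellipsoid mu beta, H beta &
      level mu = 0 \/ H = tangent_plane centered_form beta].

Definition contact_points (H : set 'cV[R]_p) : set 'cV[R]_p :=
  [set beta | exists mu, 0 <= level mu /\ tangent_at mu H beta].

End Ellipsoids.

(* Main.v *)
(* By symmetry of K the gradient of the quadratic form at beta is
   2 K (beta - beta_hat).  Tangency with the hyperplane <n, beta> = c forces this
   gradient to be a multiple of n, i.e. beta - beta_hat to be a multiple of
   K^-1 n, and the multiple is read off the equation of the hyperplane.  Hence
   every hyperplane has exactly one contact point, which lies on the line
   beta_hat + R K^-1 n and depends affinely on c. *)

Require Import Defs.
From mathcomp Require Import all_boot all_order all_algebra.
From mathcomp Require Import all_classical all_reals all_analysis.
From mathcomp Require Import ring.

Set Implicit Arguments.
Unset Strict Implicit.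
Unset Printing Implicit Defensive.

Import Order.TTheory GRing.Theory Num.Theory.
Import numFieldNormedType.Exports.

Local Open Scope classical_set_scope.
Local Open Scope ring_scope.

Section DotProduct.
Context {R : realType} {p : nat}.
Implicit Types (u v w n : 'cV[R]_p) (a c : R).

Lemma dotvE u v : dotv u v = (u^T *m v) 0 0.
Proof. by rewrite mxE; apply: eq_bigr => j _; rewrite mxE. Qed.

Lemma dotvC u v : dotv u v = dotv v u.
Proof. by apply: eq_bigr => j _; rewrite mulrC. Qed.

Lemma dotvDr u v w : dotv u (v + w) = dotv u v + dotv u w.
Proof. by rewrite !dotvE mulmxDr mxE. Qed.

Lemma dotvZr a u v : dotv u (a *: v) = a * dotv u v.
Proof. by rewrite !dotvE -scalemxAr mxE. Qed.

Lemma dotvDl u v w : dotv (u + v) w = dotv u w + dotv v w.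
Proof. by rewrite !(dotvC _ w) dotvDr. Qed.

Lemma dotvZl a u v : dotv (a *: u) v = a * dotv u v.
Proof. by rewrite !(dotvC _ v) dotvZr. Qed.

Lemma dotvBr u v w : dotv u (v - w) = dotv u v - dotv u w.
Proof. by rewrite dotvDr -scaleN1r dotvZr mulN1r. Qed.

Lemma dotv0r u : dotv u 0 = 0.
Proof. by rewrite dotvE mulmx0 mxE. Qed.

Lemma dotv_mulmxl (A : 'M[R]_p) u v : dotv (A *m u) v = dotv u (A^T *m v).
Proof. by rewrite !dotvE trmx_mul mulmxA. Qed.

Lemma dotvv_eq0 u : (dotv u u == 0) = (u == 0).
Proof.
apply/eqP/eqP => [/psumr_eq0P u0|->]; last exact: dotv0r.
apply/colP => j; rewrite mxE; apply/eqP; rewrite -sqrf_eq0 expr2.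
by apply/eqP/u0 => // i _; rewrite -expr2 sqr_ge0.
Qed.

(** After subtracting from [w] its projection on [n], the remainder is orthogonal to [n], hence to
    [w] by hypothesis, hence to itself, so it vanishes. *)
Lemma orthogonal_sub_colinear n w :
  n != 0 -> (forall u, dotv n u = 0 -> dotv w u = 0) -> exists a, w = a *: n.
Proof.
move=> n0 nw; exists (dotv n w / dotv n n); set a := _ / _.
have nnr : dotv n n != 0 by rewrite dotvv_eq0.
have nu : dotv n (w - a *: n) = 0.
  by rewrite dotvBr dotvZr /a divfK ?subrr.
apply/eqP; rewrite -subr_eq0 -dotvv_eq0 dotvBr dotvZr.
by rewrite !(dotvC (w - a *: n)) nw // nu mulr0 subr0.
Qed.

Lemma hyperplaneZ a n c :
  a != 0 -> hyperplane (a *: n) c = hyperplane n (c / a).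
Proof.
move=> a0; apply/seteqP; split=> y; rewrite /hyperplane /= dotvZl.
  by move=> <-; rewrite mulrAC mulfV ?mul1r.
by move=> ->; rewrite mulrC divfK.
Qed.

(** [parallel] only supplies some common normal [m]. Moving from [x] orthogonally to [n] stays
    inside the hyperplane, so [m] kills everything orthogonal to [n] and is a multiple of it. In (b)
    this lets one normal [n] serve all the hyperplanes. *)
Lemma parallel_hyperplane n c x H :
  n != 0 -> hyperplane n c x -> parallel H (hyperplane n c) ->
  exists e, H = hyperplane n e.
Proof.
move=> n0 nx [m [c1 [c2 [m0 -> nm]]]].
have mx : dotv m x = c2 by rewrite nm in nx.
have [|a ma] := @orthogonal_sub_colinear n m n0.
  move=> u nu; have : hyperplane n c (x + u).
    by rewrite /hyperplane /= dotvDr nu addr0.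
  by rewrite nm /hyperplane /= dotvDr mx => /(canRL (addKr _)); rewrite addNr.
have a0 : a != 0 by apply: contra_neq m0 => a0; rewrite ma a0 scale0r.
by exists (c1 / a); rewrite ma hyperplaneZ.
Qed.

Lemma l1_face_sub_hyperplane (delta : 'cV[R]_p) t :
  (forall j, delta j 0 = 1 \/ delta j 0 = -1) ->
  l1_face delta t `<=` hyperplane delta t.
Proof.
move=> hd y [<- yge0]; apply: eq_bigr => j _.
(* On the face each term [delta j 0 * y j 0] is nonnegative, so it equals its absolute value, which
   is that of [y j 0]. *)
have /normr_idP <- := yge0 j.
by rewrite normrM; case: (hd j) => ->; rewrite ?normrN normr1 mul1r.
Qed.

End DotProduct.

Section ContactPoints.
Context {R : realType} {p : nat}.
Variables (K : 'M[R]_p) (b : 'cV[R]_p) (J : R).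
Hypotheses (K_sym : K^T = K) (K_pos : posdef K).
Implicit Types (x v n : 'cV[R]_p) (c : R).

(** By symmetry a row vector in the left kernel transposes to a vector killed by [K], which
    positivity forces to be zero. *)
Lemma posdef_unitmx : K \in unitmx.
Proof.
rewrite -row_free_unit; apply: inj_row_free => v vK.
apply/eqP; rewrite -[v]trmxK trmx_eq0; apply: contraT => /K_pos.
by rewrite -[X in X *m _]K_sym -trmx_mul vK trmx0 dotvC dotv0r ltxx.
Qed.

Lemma invmx_mul_neq0 n : n != 0 -> invmx K *m n != 0.
Proof.
apply: contra_neq => /(congr1 (mulmx K)).
by rewrite mulKVmx ?posdef_unitmx // mulmx0.
Qed.

Lemma dotv_invmx_gt0 n : n != 0 -> 0 < dotv n (invmx K *m n).
Proof. by move=> /invmx_mul_neq0/K_pos; rewrite mulKVmx // posdef_unitmx. Qed.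

Lemma centered_form_ge0 x : 0 <= centered_form K b x.
Proof.
rewrite /centered_form; have [->|/K_pos/ltW //] := eqVneq (x - beta_hat K b) 0.
by rewrite dotv0r.
Qed.

Lemma centered_form_eq0 x : centered_form K b x = 0 -> x = beta_hat K b.
Proof.
move=> x0; apply/eqP; rewrite -subr_eq0; apply: contraT => /K_pos.
by rewrite -/(centered_form K b x) x0 ltxx.
Qed.

Lemma centered_formD x v : centered_form K b (x + v) =
  centered_form K b x + 2 * dotv (K *m (x - beta_hat K b)) v + dotv (K *m v) v.
Proof.
rewrite /centered_form (addrAC x v); move: (x - _) => y.
rewrite mulmxDr !dotvDl !dotvDr (dotv_mulmxl K v y) K_sym (dotvC v (K *m y)).
ring.
Qed.

Lemma derive_centered_form x v :
  'D_v (centered_form K b) x = 2 * dotv (K *m (x - beta_hat K b)) v.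
Proof.
set l := 2 * _; apply: cvg_lim => //.
(* By [centered_formD] the difference quotient is exactly this affine function of [h] when
   [h != 0]. *)
have lh : l + h * dotv (K *m v) v @[h --> (0 : R)^'] --> l.
  rewrite -[X in _ --> X]addr0 -[X in _ + X](mul0r (dotv (K *m v) v)).
  apply: cvgD; first exact: cvg_cst.
  by apply: cvgM; [exact: nbhs_dnbhs | exact: cvg_cst].
apply: cvg_trans lh; apply: near_eq_cvg; near=> h.
have h0 : h != 0 by near: h; exact: nbhs_dnbhs_neq.
rewrite /= [_ *: v + x]addrC centered_formD -scalemxAr dotvZl !dotvZr.
by rewrite /l /GRing.scale /=; field.
Unshelve. all: by end_near. Qed.

(** This includes the center, where the gradient vanishes and both sides are the whole space. *)
Lemma tangent_centered_form x : tangent_plane (centered_form K b) x =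
  hyperplane (K *m (x - beta_hat K b)) (dotv (K *m (x - beta_hat K b)) x).
Proof.
apply/seteqP; split=> y;
  rewrite /tangent_plane /hyperplane /= derive_centered_form.
  by move=> /eqP; rewrite mulf_eq0 pnatr_eq0 /= dotvBr subr_eq0 => /eqP.
by move=> yx; rewrite dotvBr yx subrr mulr0.
Qed.

Lemma contact_points_hyperplane n c : n != 0 ->
  contact_points K b J (hyperplane n c) =
  [set beta_hat K b + ((c - dotv n (beta_hat K b)) / dotv n (invmx K *m n))
                       *: (invmx K *m n)].
Proof.
move=> n0; have q0 : dotv n (invmx K *m n) != 0 by rewrite gt_eqF ?dotv_invmx_gt0.
apply/seteqP; split=> [x [mu [_ [xE xH tangent]]]|_ ->].
  have [a xa] : exists a, x - beta_hat K b = a *: (invmx K *m n).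
    case: tangent => [mu0|].
      exists 0; rewrite scale0r; apply/eqP; rewrite subr_eq0; apply/eqP.
      by apply: centered_form_eq0; rewrite xE mu0.
    rewrite tangent_centered_form => HT.
    (* For [u] orthogonal to [n], the point [x + u] stays in the hyperplane, that is, in the tangent
       plane, so the gradient is orthogonal to [u]. *)
    have [|a wa] := @orthogonal_sub_colinear _ _ n (K *m (x - beta_hat K b)) n0.
      move=> u nu; have : hyperplane n c (x + u).
        by rewrite /hyperplane /= dotvDr nu addr0.
      by rewrite HT /hyperplane /= dotvDr => /(canRL (addKr _)); rewrite addNr.
    by exists a; rewrite scalemxAr -wa mulKmx ?posdef_unitmx.
  rewrite /= -[LHS](subrK (beta_hat K b)) addrC xa; congr (_ + _ *: _).
  by rewrite -xH -dotvBr xa dotvZr mulfK.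
set s := _ / _; set x := _ + _.
have xH : dotv n x = c by rewrite /x dotvDr dotvZr divfK // addrC subrK.
(* Conversely, choose the [mu] whose ellipsoid passes through [x]. *)
have levelE : level K b J
    (centered_form K b x - dotv (invmx K *m b) b + J) = centered_form K b x.
  by rewrite /level; ring.
exists (centered_form K b x - dotv (invmx K *m b) b + J).
split; first by rewrite levelE centered_form_ge0.
split=> //.
have Kx : K *m (x - beta_hat K b) = s *: n.
  by rewrite /x addrAC subrr add0r -scalemxAr mulKVmx ?posdef_unitmx.
(* If [s = 0], then [x] is the center and the degenerate convention applies; otherwise half the
   gradient, [s *: n], is a genuine normal. *)
rewrite levelE; have [s0|s0] := eqVneq s 0; [left|right].
  by rewrite /centered_form Kx s0 scale0r dotvC dotv0r.
by rewrite tangent_centered_form Kx dotvZl xH hyperplaneZ // mulrAC mulfV ?mul1r.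
Qed.

End ContactPoints.

Theorem proposition3p1 (R : realType) (p : nat) (hp : (2 <= p)%N)
    (K1 : 'M[R]_p) (K1_sym : K1^T = K1) (K1_pos : posdef K1)
    (b : 'cV[R]_p) (Jkk : R) :
  (* (a) *)
  (forall (delta : 'cV[R]_p) (I : set R),
     (forall j, delta j 0 = 1 \/ delta j 0 = -1) ->
     is_interval I -> (forall t, I t -> 0 < t) ->
     (forall t, I t -> l1_face delta t `<=` hyperplane delta t) /\
     exists x d : 'cV[R]_p,
       [/\ d != 0,
           line x d (beta_hat K1 b) &
           \bigcup_(t in I) contact_points K1 b Jkk (hyperplane delta t)
             = [set x + t *: d | t in I]]) /\
  (* (b) *)
  (forall (n : 'cV[R]_p) (c : R) (U H1 H2 : set 'cV[R]_p),
     n != 0 -> hyperplane n c (beta_hat K1 b) ->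
     U = upper_half_space n c \/ U = lower_half_space n c ->
     parallel H1 H2 ->
     parallel H1 (hyperplane n c) -> parallel H2 (hyperplane n c) ->
     H1 `<=` U -> H2 `<=` U ->
     exists d : 'cV[R]_p,
       [/\ d != 0,
           contact_points K1 b Jkk H1 !=set0,
           contact_points K1 b Jkk H2 !=set0 &
           contact_points K1 b Jkk H1 `|` contact_points K1 b Jkk H2
             `<=` ray (beta_hat K1 b) d]).

Proof.
split=> [delta I hdelta _ _|n c U H1 H2 n0 nc].
  split=> [t _|]; first exact: l1_face_sub_hyperplane.
  have delta0 : delta != 0.
    (* The bound on [p] provides a coordinate, where [delta] is 1 or -1. *)
    apply/eqP => d0; have := hdelta (Ordinal (ltnW hp)).
    rewrite d0 mxE => -[/esym/eqP|/esym/eqP]; first by rewrite oner_eq0.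
    by rewrite oppr_eq0 oner_eq0.
  set q := dotv delta (invmx K1 *m delta).
  set e := dotv delta (beta_hat K1 b).
  have q0 : 0 < q by exact: dotv_invmx_gt0.
  (* Since [dotv delta d = 1], the line can be parametrized by [t] itself; the center is then at
     parameter [e]. *)
  pose d := q^-1 *: (invmx K1 *m delta).
  have pointE t : beta_hat K1 b + ((t - e) / q) *: (invmx K1 *m delta) =
      beta_hat K1 b - e *: d + t *: d.
    by rewrite /d -scalerA scalerBl addrA addrAC.
  exists (beta_hat K1 b - e *: d), d; split.
  - by rewrite scaler_eq0 negb_or invr_eq0 gt_eqF //= invmx_mul_neq0.
  - by exists e => //; rewrite subrK.
  - apply/seteqP; split=> [y [t It]|_ [t It <-]].
      by rewrite contact_points_hyperplane // => ->; exists t; rewrite // -pointE.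
    by exists t => //; rewrite contact_points_hyperplane //= -pointE.
have q0 : 0 < dotv n (invmx K1 *m n) by exact: dotv_invmx_gt0.
move=> hU _ /(parallel_hyperplane n0 nc)[c1 ->] /(parallel_hyperplane n0 nc)[c2 ->].
rewrite !contact_points_hyperplane // nc.
(* An explicit point of each hyperplane turns its inclusion in [U] into a comparison of [c1] or [c2]
   with [c]. *)
have on_hyperplane c' : hyperplane n c' ((c' / dotv n n) *: n).
  by rewrite /hyperplane /= dotvZr divfK // dotvv_eq0.
move=> /(_ _ (on_hyperplane c1)) U1 /(_ _ (on_hyperplane c2)) U2.
(* The sign [sg] treats both half-spaces at once: it is 1 for the upper one and -1 for the lower
   one, and it orients the ray. *)
have [sg [sg0 sg1 sg2]] : exists sg : R,
    [/\ sg * sg = 1, 0 <= sg * (c1 - c) & 0 <= sg * (c2 - c)].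
  case: hU U1 U2 => ->; rewrite /upper_half_space /lower_half_space /=;
    rewrite !on_hyperplane => U1 U2.
    by exists 1; rewrite !mul1r !subr_ge0 !ltW.
  by exists (-1); rewrite mulrNN !mulN1r !opprB !subr_ge0 !ltW ?mul1r.
exists (sg *: (invmx K1 *m n)); split.
- rewrite scaler_eq0 negb_or invmx_mul_neq0 // andbT.
  by apply: contra_eq_neq sg0 => ->; rewrite mul0r eq_sym oner_eq0.
- by eexists.
- by eexists.
have on_ray c' : 0 <= sg * (c' - c) ->
    ray (beta_hat K1 b) (sg *: (invmx K1 *m n))
      (beta_hat K1 b + ((c' - c) / dotv n (invmx K1 *m n)) *: (invmx K1 *m n)).
  (* The sign occurs in both the parameter and the direction, and its square is 1. *)
  move=> ge0; exists (sg * (c' - c) / dotv n (invmx K1 *m n)).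
    by rewrite /= divr_ge0 // ltW.
  by rewrite scalerA mulrAC [_ * _ * sg]mulrAC sg0 mul1r.
by move=> y [] ->; apply: on_ray.
Qed.
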